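(* Let $\&$ be a continuous t-norm and let $M>0$. The following are equivalent: (1) $(\mathbb{E}^1_{[-M,M]},P)$ is complete; (2) $(\mathbb{E}^1_{[-M,M]},P)$ is cocomplete; (3) $(\mathbb{E}^1_{[-M,M]},P)$ is tensored; (4) $(\mathbb{E}^1_{[-M,M]},P)$ is cotensored; (5) $\&=\wedge$, i.e. $x\,\&\,y=\min\{x,y\}$ for all $x,y\in[0,1]$.
   Context: T-norms: a t-norm is a commutative, associative binary operation $\&$ on $[0,1]$, monotone in each variable, with $x\,\&\,1=x$. Its residual implication is $x\to y=\sup\{t\in[0,1]\mid x\,\&\,t\le y\}$. Fuzzy numbers: $\mathbb{E}^1$ is the set of functions $u:\mathbb{R}\to[0,1]$ such that (1) $u(x_0)=1$ for some $x_0$; (2) $u(\lambda x+(1-\lambda)y)\ge\min\{u(x),u(y)\}$ for all $x,y\in\mathbb{R},\lambda\in[0,1]$; (3) $u$ is upper-semicontinuous; (4) $[u]_0=\overline{\{x: u(x)>0\}}$ is compact. Put $[u]_\alpha=\{x: u(x)\ge\alpha\}$ for $\alpha\in(0,1]$ and write $[u]_\alpha=[u_\alpha^-,u_\alpha^+]$. The left and right parts of $u$ are $u^\ell,u^r:\mathbb{R}\to[0,1]$: $u^\ell(x)=0$ for $x<u_0^-$, $u^\ell(x)=u(x)$ for $x\in[u_0^-,u_1^-]$, $u^\ell(x)=1$ for $x>u_1^-$; $u^r(x)=1$ for $x<u_1^-$, $u^r(x)=u(x)$ for $x\in[u_1^-,u_0^+]$, $u^r(x)=0$ for $x>u_0^+$.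 Define $P(u,v)=\inf_{x\in\mathbb{R}}\big((v^\ell(x)\to u^\ell(x))\wedge(u^r(x)\to v^r(x))\big)$. For $M>0$, $\mathbb{E}^1_{[-M,M]}$ is the set of $u\in\mathbb{E}^1$ with support $[u]_0\subseteq[-M,M]$. Enriched categories: a $[0,1]$-enriched category is a set $X$ with a map $X(-,-):X\times X\to[0,1]$ such that $X(x,x)=1$ and $X(y,z)\,\&\,X(x,y)\le X(x,z)$. Here $X=\mathbb{E}^1_{[-M,M]}$ and $X(u,v)=P(u,v)$. A weight is a map $\phi:X\to[0,1]$ with $X(y,x)\le\phi(x)\to\phi(y)$; a coweight is a map $\psi:X\to[0,1]$ with $X(x,y)\le\psi(x)\to\psi(y)$. A colimit of $\phi$ is an element $c$ with $X(c,x)=\inf_{y\in X}(\phi(y)\to X(y,x))$ for all $x$; a limit of $\psi$ is an element $l$ with $X(x,l)=\inf_{y\in X}(\psi(y)\to X(x,y))$ for all $x$. $X$ is cocomplete if every weight has a colimit, and complete if every coweight has a limit. For $r\in[0,1]$ and $x\in X$, a tensor $r\otimes x$ is an element of $X$ with $X(r\otimes x,y)=r\to X(x,y)$ for all $y\in X$; for $y\in X$, a cotensor $r\multimap y$ is an element with $X(x,r\multimap y)=r\to X(x,y)$ for all $x\in X$. $X$ is tensored (cotensored) if all tensors (cotensors) exist. *)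

(* Defs.v *)
From HB Require Import structures.
From mathcomp Require Import all_boot all_order all_algebra.
From mathcomp Require Import all_classical all_reals all_analysis.

Set Implicit Arguments.
Unset Strict Implicit.
Unset Printing Implicit Defensive.

Import Order.TTheory GRing.Theory Num.Theory.
Import numFieldNormedType.Exports.

Local Open Scope classical_set_scope.
Local Open Scope ring_scope.

(* The quantale [0,1] is represented inside R : a t-norm is a function on R   *)
(* whose values outside of [0,1] are irrelevant, and [0,1]-valued maps are    *)
(* real-valued maps with an explicit bound. Every [sup] or [inf] below is     *)
(* taken over a nonempty bounded set, where it is the usual one.              *)

Record is_tnorm (R : realType) (T : R -> R -> R) : Prop := IsTnorm {
  tnorm_itv : forall x y, 0 <= x <= 1 -> 0 <= y <= 1 -> 0 <= T x y <= 1;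
  tnormC : forall x y, 0 <= x <= 1 -> 0 <= y <= 1 -> T x y = T y x;
  tnormA : forall x y z, 0 <= x <= 1 -> 0 <= y <= 1 -> 0 <= z <= 1 ->
    T x (T y z) = T (T x y) z;
  tnorm_monol : forall x y z, 0 <= x <= 1 -> 0 <= y <= 1 -> 0 <= z <= 1 ->
    x <= y -> T x z <= T y z;
  tnorm_monor : forall x y z, 0 <= x <= 1 -> 0 <= y <= 1 -> 0 <= z <= 1 ->
    y <= z -> T x y <= T x z;
  tnorm1 : forall x, 0 <= x <= 1 -> T x 1 = x }.

Definition continuous_tnorm (R : realType) (T : R -> R -> R) : Prop :=
  is_tnorm T /\
  {within `[0, 1] `*` `[0, 1], continuous (fun p : R * R => T p.1 p.2)}.

Definition residual (R : realType) (T : R -> R -> R) (x y : R) : R :=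
  sup [set t | 0 <= t <= 1 /\ T x t <= y].

Definition upper_semicontinuous (R : realType) (u : R -> R) : Prop :=
  forall x a, u x < a -> \forall y \near x, u y < a.

Definition level_set (R : realType) (u : R -> R) (a : R) : set R :=
  if a == 0 then closure [set x | 0 < u x] else [set x | a <= u x].

Record fuzzy_number (R : realType) (u : R -> R) : Prop := FuzzyNumber {
  fuzzy_itv : forall x, 0 <= u x <= 1;
  fuzzy_normal : exists x0, u x0 = 1;
  fuzzy_convex : forall x y l, 0 <= l <= 1 ->
    Num.min (u x) (u y) <= u (l * x + (1 - l) * y);
  fuzzy_usc : upper_semicontinuous u;
  fuzzy_compact : compact (level_set u 0) }.

(* For a fuzzy number u, [level_set u a] is `[cutl u a, cutr u a].            *)
Definition cutl (R : realType) (u : R -> R) (a : R) : R := inf (level_set u a).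
Definition cutr (R : realType) (u : R -> R) (a : R) : R := sup (level_set u a).

Definition left_part (R : realType) (u : R -> R) (x : R) : R :=
  if x < cutl u 0 then 0 else if x <= cutl u 1 then u x else 1.

Definition right_part (R : realType) (u : R -> R) (x : R) : R :=
  if x < cutl u 1 then 1 else if x <= cutr u 0 then u x else 0.

Definition fuzzyP (R : realType) (T : R -> R -> R) (u v : R -> R) : R :=
  inf (range (fun x : R =>
    Num.min (residual T (left_part v x) (left_part u x))
            (residual T (right_part u x) (right_part v x)))).

Definition E1 (R : realType) (M : R) : Type :=
  {u : R -> R | fuzzy_number u /\ level_set u 0 `<=` `[- M, M]}.

Definition E1hom (R : realType) (T : R -> R -> R) (M : R) (u v : E1 M) : R :=
  fuzzyP T (sval u) (sval v).

Record enriched_category (R : realType) (T : R -> R -> R) (X : Type)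
    (hom : X -> X -> R) : Prop := EnrichedCategory {
  hom_itv : forall x y, 0 <= hom x y <= 1;
  hom_refl : forall x, hom x x = 1;
  hom_comp : forall x y z, T (hom y z) (hom x y) <= hom x z }.

Definition weight (R : realType) (T : R -> R -> R) (X : Type)
    (hom : X -> X -> R) (phi : X -> R) : Prop :=
  (forall x, 0 <= phi x <= 1) /\
  (forall x y, hom y x <= residual T (phi x) (phi y)).

Definition coweight (R : realType) (T : R -> R -> R) (X : Type)
    (hom : X -> X -> R) (psi : X -> R) : Prop :=
  (forall x, 0 <= psi x <= 1) /\
  (forall x y, hom x y <= residual T (psi x) (psi y)).

Definition is_colimit (R : realType) (T : R -> R -> R) (X : Type)
    (hom : X -> X -> R) (phi : X -> R) (c : X) : Prop :=
  forall x, hom c x = inf (range (fun y => residual T (phi y) (hom y x))).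

Definition is_limit (R : realType) (T : R -> R -> R) (X : Type)
    (hom : X -> X -> R) (psi : X -> R) (l : X) : Prop :=
  forall x, hom x l = inf (range (fun y => residual T (psi y) (hom x y))).

Definition cocomplete (R : realType) (T : R -> R -> R) (X : Type)
    (hom : X -> X -> R) : Prop :=
  forall phi, weight T hom phi -> exists c, is_colimit T hom phi c.

Definition complete (R : realType) (T : R -> R -> R) (X : Type)
    (hom : X -> X -> R) : Prop :=
  forall psi, coweight T hom psi -> exists l, is_limit T hom psi l.

Definition is_tensor (R : realType) (T : R -> R -> R) (X : Type)
    (hom : X -> X -> R) (r : R) (x t : X) : Prop :=
  forall y, hom t y = residual T r (hom x y).

Definition is_cotensor (R : realType) (T : R -> R -> R) (X : Type)
    (hom : X -> X -> R) (r : R) (y t : X) : Prop :=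
  forall x, hom x t = residual T r (hom x y).

Definition tensored (R : realType) (T : R -> R -> R) (X : Type)
    (hom : X -> X -> R) : Prop :=
  forall r x, 0 <= r <= 1 -> exists t, is_tensor T hom r x t.

Definition cotensored (R : realType) (T : R -> R -> R) (X : Type)
    (hom : X -> X -> R) : Prop :=
  forall r y, 0 <= r <= 1 -> exists t, is_cotensor T hom r y t.

Lemma residual_itv (R : realType) (T : R -> R -> R) (x y : R) :
  is_tnorm T -> 0 <= x <= 1 -> 0 <= y <= 1 -> 0 <= residual T x y <= 1.
Proof.
move=> hT hx hy; have h0 : 0 <= (0 : R) <= 1 by rewrite lexx ler01.
have h1 : 0 <= (1 : R) <= 1 by rewrite lexx ler01.
have Tx0 : T x 0 <= y.
  rewrite (tnormC hT) //; apply: (@le_trans _ _ 0); last by case/andP: hy.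
  rewrite -[leRHS](tnorm1 hT) //; apply: (tnorm_monor hT) => //.
  by case/andP: hx.
apply/andP; split.
  apply: ub_le_sup; last by split.
  by exists 1 => t /= [/andP[]].
apply: ge_sup; first by exists 0; split.
by move=> t /= [/andP[]].
Qed.

Lemma residualP (R : realType) (T : R -> R -> R) (x y t : R) :
  continuous_tnorm T -> 0 <= x <= 1 -> 0 <= y <= 1 -> 0 <= t <= 1 ->
  (T x t <= y) <-> (t <= residual T x y).
Proof.
move=> [hT cT] hx hy ht; split => [le_y|].
  by apply: ub_le_sup; [exists 1 => s /= [/andP[]]|split].
move=> ts; set s := residual T x y in ts.
have hs : 0 <= s <= 1 by exact: residual_itv.
apply: le_trans (tnorm_monor hT hx ht hs ts) _.
rewrite leNgt; apply/negP => yT.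
have Ds : (`[0, 1] `*` `[0, 1])%classic (x, s) by split; rewrite /= in_itv.
move/subspace_continuousP: cT => /(_ _ Ds) cxs.
have /cvgrPdist_lt/(_ (T x s - y)) := cxs.
rewrite subr_gt0 => /(_ yT); rewrite /prop_near1/= /within/=.
case=> -[U V] /= [Ux /nbhs_ballP[e /= e0 eV]] UV.
have h0 : 0 <= (0 : R) <= 1 by rewrite lexx ler01.
have sS : has_sup [set t | 0 <= t <= 1 /\ T x t <= y].
  split; last by exists 1 => t' /= [/andP[]].
  exists 0; split=> //; rewrite (tnormC hT) //.
  apply: (@le_trans _ _ 0); last by case/andP: hy.
  rewrite -[leRHS](tnorm1 hT) //.
  by apply: (tnorm_monor hT) => //; [rewrite lexx ler01|case/andP: hx].
have [t' [ht' Tt'] st'] := sup_adherent e0 sS.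
have t's : t' <= s by apply: ub_le_sup; [exact: sS.2|split].
have Vt' : V t'.
  by apply: eV; rewrite /ball /= ger0_norm ?subr_ge0// ltrBlDr -ltrBlDl.
have := UV (x, t') (conj (nbhs_singleton Ux) Vt').
have Dt' : (`[0, 1] `*` `[0, 1])%classic (x, t') by split; rewrite /= in_itv.
move=> /(_ Dt') /=; rewrite ltNge => /negP; apply.
by rewrite (le_trans _ (ler_norm _))// lerD2l lerN2.
Qed.

Lemma left_part_itv (R : realType) (u : R -> R) (x : R) :
  fuzzy_number u -> 0 <= left_part u x <= 1.
Proof.
move=> hu; rewrite /left_part; case: ifP => _; first by rewrite lexx ler01.
by case: ifP => _; [exact: fuzzy_itv|rewrite lexx ler01].
Qed.

Lemma right_part_itv (R : realType) (u : R -> R) (x : R) :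
  fuzzy_number u -> 0 <= right_part u x <= 1.
Proof.
move=> hu; rewrite /right_part; case: ifP => _; first by rewrite lexx ler01.
by case: ifP => _; [exact: fuzzy_itv|rewrite lexx ler01].
Qed.

Lemma residual_refl (R : realType) (T : R -> R -> R) (x : R) :
  continuous_tnorm T -> 0 <= x <= 1 -> residual T x x = 1.
Proof.
move=> cT hx; have h1 : 0 <= (1 : R) <= 1 by rewrite lexx ler01.
apply/eqP; rewrite eq_le; apply/andP; split.
  by have /andP[] := residual_itv cT.1 hx hx.
by apply/(residualP cT hx hx h1); rewrite (tnorm1 cT.1).
Qed.

Lemma residual_comp (R : realType) (T : R -> R -> R) (x y z : R) :
  continuous_tnorm T -> 0 <= x <= 1 -> 0 <= y <= 1 -> 0 <= z <= 1 ->
  T (residual T y z) (residual T x y) <= residual T x z.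
Proof.
move=> cT hx hy hz; have hT := cT.1.
have hxy := residual_itv hT hx hy; have hyz := residual_itv hT hy hz.
apply/(residualP cT hx hz (tnorm_itv hT hyz hxy)).
rewrite (tnormC hT hyz hxy) (tnormA hT)//.
apply: (@le_trans _ _ (T y (residual T y z))); last exact/residualP.
by apply: (tnorm_monol hT) => //; [exact: (tnorm_itv hT)|exact/residualP].
Qed.

Lemma fuzzyP_has_inf (R : realType) (T : R -> R -> R) (u v : R -> R) :
  is_tnorm T -> fuzzy_number u -> fuzzy_number v ->
  has_inf (range (fun x : R =>
    Num.min (residual T (left_part v x) (left_part u x))
            (residual T (right_part u x) (right_part v x)))).
Proof.
move=> hT hu hv; split; first by eexists; exists 0.
exists 0 => _ [x _ <-]; rewrite le_min.
have /andP[-> _] := residual_itv hT (left_part_itv x hv) (left_part_itv x hu).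
by have /andP[-> _] :=
  residual_itv hT (right_part_itv x hu) (right_part_itv x hv).
Qed.

Lemma E1_enriched (R : realType) (T : R -> R -> R) (M : R) :
  continuous_tnorm T -> enriched_category T (@E1hom R T M).
Proof.
move=> cT; have hT := cT.1.
have itv (u v : E1 M) : 0 <= E1hom T u v <= 1.
  case: u v => [u [hu Mu]] [v [hv Mv]]; rewrite /E1hom /fuzzyP /=.
  have [ne lb] := fuzzyP_has_inf hT hu hv.
  have hl := residual_itv hT (left_part_itv 0 hv) (left_part_itv 0 hu).
  have hr := residual_itv hT (right_part_itv 0 hu) (right_part_itv 0 hv).
  apply/andP; split.
    apply: lb_le_inf => // _ [x _ <-]; rewrite le_min.
    have /andP[-> _] := residual_itv hT (left_part_itv x hv) (left_part_itv x hu).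
    by have /andP[] :=
      residual_itv hT (right_part_itv x hu) (right_part_itv x hv).
  apply: le_trans (ge_inf lb (imageT _ 0)) _.
  by rewrite ge_min; case/andP: hl => _ ->.
split => [//|[u [hu Mu]]|u v w].
  rewrite /E1hom /fuzzyP /=.
  rewrite -[RHS]inf1; congr inf; apply/seteqP; split => [_ [x _ <-]|_ ->].
    by rewrite !residual_refl ?minxx//; exact: left_part_itv || exact: right_part_itv.
  exists 0 => //.
  by rewrite !residual_refl ?minxx//; exact: left_part_itv || exact: right_part_itv.
have := itv u v; have := itv v w.
case: u v w => [u [hu Mu]] [v [hv Mv]] [w [hw Mw]] hvw huv.
rewrite {3}/E1hom /fuzzyP /=; apply: lb_le_inf.
  exact: (fuzzyP_has_inf hT hu hw).1.
move=> _ [x _ <-].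
have hul := left_part_itv x hu; have hur := right_part_itv x hu.
have hvl := left_part_itv x hv; have hvr := right_part_itv x hv.
have hwl := left_part_itv x hw; have hwr := right_part_itv x hw.
have := ge_inf (fuzzyP_has_inf hT hv hw).2 (imageT _ x).
have := ge_inf (fuzzyP_has_inf hT hu hv).2 (imageT _ x).
rewrite -!/(fuzzyP _ _ _) !le_min => /andP[uvl uvr] /andP[vwl vwr].
move: hvw huv; rewrite /E1hom /= => hvw huv; apply/andP; split.
  rewrite (tnormC hT) //; apply: le_trans (residual_comp cT hwl hvl hul).
  have a1 := residual_itv hT hvl hul; have a2 := residual_itv hT hwl hvl.
  by apply: le_trans (tnorm_monor hT _ _ _ vwl); [apply: (tnorm_monol hT)|..].
apply: le_trans (residual_comp cT hur hvr hwr).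
have a1 := residual_itv hT hvr hwr; have a2 := residual_itv hT hur hvr.
by apply: le_trans (tnorm_monor hT _ _ _ uvr); [apply: (tnorm_monol hT)|..].
Qed.

(* Main.v *)
Require Import Defs.
From mathcomp Require Import all_boot all_order all_algebra.
From mathcomp Require Import all_classical all_reals all_analysis.
From mathcomp Require Import ring lra.
Import Order.TTheory GRing.Theory Num.Theory.
Import numFieldNormedType.Exports.
Set Implicit Arguments.
Unset Strict Implicit.
Unset Printing Implicit Defensive.
Local Open Scope classical_set_scope.
Local Open Scope ring_scope.

(** Write [X] for the fuzzy numbers supported in [[-M, M]].

    A fuzzy number is the same thing as the pair of its left part (increasing)
    and its right part (decreasing), both upper semicontinuous, and both equal
    to 1 at some common point ([E1_of_parts], [E1_ext]). In these terms
    [r <= P(u, v)] says that, at every point, [v^l & r <= u^l] and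
    [u^r & r <= v^r] ([le_hom]), so the whole argument is about pairs of
    monotone functions.

    Reflecting the line exchanges the two parts, and hence is an involution
    [mirror] of [X] with [P(mirror u, mirror v) = P(v, u)]. So [X] is isomorphic
    to its opposite, which gives complete => cocomplete and tensored =>
    cotensored for free. Cocomplete => tensored holds in every enriched
    category: [r (x) x] is the colimit of the weight [r & X(-, x)].

    Cotensored => [& = min] ([cotensored_idem]). Fix [r], put [c = r & r], let
    [u] be the step [c] on [[-M, M[] with value 1 at [M], let [y] be its mirror
    image, and let [L] be the cotensor of [y] by [r]. Where [y^l] is nonzero
    [u^l >= c], and where [u^r] is nonzero [y^r >= c]; so [r & r <= P(u, y)],
    that is, [r <= P(u, L)], hence [L^l(0) & r <= u^l(0) = c]. On the other hand
    [1 <= P(L, L)] gives [r <= P(L, y)], hence [L^r(0) & r <= y^r(0) = c].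
    At any point one of the two parts of a fuzzy number is 1, and either way
    [r <= c]. So every [r] is idempotent, which characterizes the minimum.

    [& = min] => complete ([min_complete]). Given a coweight [psi], the limit
    wants to have the left part [A = sup_y (psi y & y^l)] and the right part
    [B = inf_y (psi y -> y^r)], the latter cut off to 0 beyond [M]. This pair is
    in general no fuzzy number: for the constant [psi = 1/2], [A] never exceeds
    1/2. The remedy is to raise [A] to 1 wherever [B < 1]. The condition on [x]
    and [r] is then formally stronger, as it demands [r <= x^l] there, but this
    already holds: if [x^r < 1] then [x^l = 1], and if [x^r = 1] then
    [r <= B < 1] provides a [y] with [r <= y^r < psi y], thus [y^l = 1] and
    [r = r & psi y & y^l <= x^l], where the equality uses idempotence.
    Finally [A] is made right-continuous, which is harmless as [x^l] is. *)

(** * Left and right parts of a fuzzy number *)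

Lemma fuzzy_support_bounded (R : realType) (u : R -> R) :
  fuzzy_number u -> has_lbound (level_set u 0) /\ has_ubound (level_set u 0).
Proof.
move=> /fuzzy_compact/compact_bounded[B [_ /(_ (B + 1))]].
rewrite ltrDl ltr01 => /(_ isT) bB.
by split; [exists (- (B + 1))|exists (B + 1)] => x /bB /=;
  rewrite ler_norml => /andP[].
Qed.

Lemma fuzzy_between (R : realType) (u : R -> R) (x y z : R) :
  fuzzy_number u -> x <= y <= z -> Num.min (u x) (u z) <= u y.
Proof.
move=> hu /andP[xy yz]; have [xz|xz] := eqVneq x z.
  have -> : y = x by apply/le_anti; rewrite xy andbT xz.
  by rewrite ge_min lexx.
have d0 : 0 < z - x by rewrite subr_gt0 lt_neqAle xz (le_trans xy).
set l := (z - y) / (z - x).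
have hl : 0 <= l <= 1.
  rewrite divr_ge0 ?subr_ge0 ?(le_trans xy)//=.
  by rewrite ler_pdivrMr// mul1r lerD2l lerN2.
have -> : y = l * x + (1 - l) * z by rewrite /l; field; rewrite gt_eqF.
exact: fuzzy_convex.
Qed.

(** Upper semicontinuity makes the infimum [cutl u 1] a point of the 1-level
    set, and convexity fills the interval up to [q]. *)
Lemma fuzzy_left_peak (R : realType) (u : R -> R) (q : R) :
  fuzzy_number u -> u q = 1 -> [/\ cutl u 1 <= q, u (cutl u 1) = 1 &
    forall x, cutl u 1 <= x <= q -> u x = 1].
Proof.
move=> hu uq; have [[a la] _] := fuzzy_support_bounded hu.
have u1E x : u x = 1 <-> level_set u 1 x.
  rewrite /level_set oner_eq0 /=; split=> [->//|ux].
  by apply/le_anti; rewrite ux; case/andP: (fuzzy_itv hu x) => _ ->.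
have lb1 : has_lbound (level_set u 1).
  exists a => x /u1E ux; apply: la; rewrite /level_set eqxx.
  by apply: subset_closure; rewrite /= ux ltr01.
have ne1 : level_set u 1 !=set0 by exists q; exact/u1E.
have cq : cutl u 1 <= q by apply: ge_inf => //; exact/u1E.
have uc : u (cutl u 1) = 1.
  apply/eqP; apply: contraT => /eqP uc.
  have /(fuzzy_usc hu)/nbhs_ballP[e /= e0 eu] : u (cutl u 1) < 1.
    rewrite lt_neqAle; case/andP: (fuzzy_itv hu (cutl u 1)) => _ ->.
    by rewrite andbT; exact/eqP.
  have [z uz ze] := inf_adherent e0 (conj ne1 lb1).
  have zc : cutl u 1 <= z by exact: ge_inf.
  have /eu /= : ball (cutl u 1) e z.
    by rewrite /ball /= distrC ger0_norm ?subr_ge0// ltrBlDl.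
  by move/u1E: uz => ->; rewrite ltxx.
split=> // x cxq; apply/le_anti; case/andP: (fuzzy_itv hu x) => _ -> /=.
by have := fuzzy_between hu cxq; rewrite uc uq minxx.
Qed.

(** The parts may be split at any point [q] where [u] peaks, instead of the
    prescribed ends of the level sets: [u] is 1 between [cutl u 1] and [q], and
    vanishes outside of its support. This removes level sets from everything
    that follows. *)
Lemma left_partE (R : realType) (u : R -> R) (q x : R) :
  fuzzy_number u -> u q = 1 -> left_part u x = if x < q then u x else 1.
Proof.
move=> hu uq; have [cq uc u1] := fuzzy_left_peak hu uq.
have [lb _] := fuzzy_support_bounded hu.
have pos y : 0 < u y -> cutl u 0 <= y.
  move=> uy; apply: ge_inf => //; rewrite /level_set eqxx.
  exact: subset_closure.
rewrite /left_part; case: ifPn => [x0|_].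
  rewrite (lt_le_trans x0) ?pos ?uq//.
  by apply/le_anti; case/andP: (fuzzy_itv hu x) => -> _; rewrite leNgt;
    apply: contraTN x0 => /pos; rewrite -leNgt.
case: ifPn => [xc|]; last first.
  by rewrite -ltNge => /ltW cx; case: ifPn => // /ltW xq; rewrite u1// cx.
have := le_trans xc cq; rewrite le_eqVlt => /predU1P[->|->//].
by rewrite ltxx.
Qed.

Lemma right_partE (R : realType) (u : R -> R) (q x : R) :
  fuzzy_number u -> u q = 1 -> right_part u x = if x <= q then 1 else u x.
Proof.
move=> hu uq; have [cq uc u1] := fuzzy_left_peak hu uq.
have [_ ub] := fuzzy_support_bounded hu.
have pos y : 0 < u y -> y <= cutr u 0.
  move=> uy; apply: ub_le_sup => //; rewrite /level_set eqxx.
  exact: subset_closure.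
rewrite /right_part; case: ifPn => [/ltW xc|]; first by rewrite (le_trans xc).
rewrite -leNgt => cx; case: (leP x q) => xq.
  by rewrite (le_trans xq) ?pos ?uq// u1// cx.
case: ifPn => // x0; apply/le_anti; case/andP: (fuzzy_itv hu x) => -> _ /=.
by rewrite leNgt; apply: contraNN x0 => /pos.
Qed.

Lemma E1_fuzzy (R : realType) (M : R) (u : E1 M) : fuzzy_number (sval u).
Proof. by case: u => u []. Qed.

Lemma E1_peak (R : realType) (M : R) (u : E1 M) :
  exists2 q, - M <= q <= M & sval u q = 1.
Proof.
case: u => u /= [hu uM]; have [q uq] := fuzzy_normal hu; exists q => //.
have /uM : level_set u 0 q.
  by rewrite /level_set eqxx; apply: subset_closure; rewrite /= uq.
by rewrite /= in_itv.
Qed.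

Lemma sval_out (R : realType) (M : R) (u : E1 M) x :
  ~~ (- M <= x <= M) -> sval u x = 0.
Proof.
case: u => u /= [hu uM]; apply: contraNeq => ux.
have /uM : level_set u 0 x.
  rewrite /level_set eqxx; apply: subset_closure.
  rewrite /= lt_neqAle eq_sym ux.
  by case/andP: (fuzzy_itv hu x).
by rewrite /= in_itv.
Qed.

Definition lpart (R : realType) (M : R) (u : E1 M) := left_part (sval u).
Definition rpart (R : realType) (M : R) (u : E1 M) := right_part (sval u).

Lemma lpart_itv (R : realType) (M : R) (u : E1 M) x : 0 <= lpart u x <= 1.
Proof. exact: left_part_itv (E1_fuzzy u). Qed.

Lemma rpart_itv (R : realType) (M : R) (u : E1 M) x : 0 <= rpart u x <= 1.
Proof. exact: right_part_itv (E1_fuzzy u). Qed.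

(** On either side of a peak one of the two parts is 1. *)
Lemma sval_parts (R : realType) (M : R) (u : E1 M) x :
  sval u x = Num.min (lpart u x) (rpart u x).
Proof.
have [q _ uq] := E1_peak u; have hu := E1_fuzzy u.
rewrite /lpart /rpart (left_partE _ hu uq) (right_partE _ hu uq).
case/andP: (fuzzy_itv hu x) => _ u1; case: (ltgtP x q) => [||->].
- by rewrite (min_idPl u1).
- by rewrite (min_idPr u1).
- by rewrite minxx.
Qed.

Lemma E1_ext (R : realType) (M : R) (u v : E1 M) :
  lpart u =1 lpart v -> rpart u =1 rpart v -> u = v.
Proof.
move=> el er; apply: eq_sig_hprop => [? ? ?|]; first exact: Prop_irrelevance.
by apply/funext => x; rewrite !sval_parts el er.
Qed.

(** Converse construction: the fuzzy number is [min f g]. Its parts are [f] and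
    [g] because [g = 1] to the left of [q] and [f = 1] to the right of it. *)
Lemma E1_of_parts (R : realType) (M : R) (f g : R -> R) (q : R) :
  {homo f : x y / x <= y} -> {homo g : x y / x <= y >-> y <= x} ->
  upper_semicontinuous f -> upper_semicontinuous g ->
  (forall x, 0 <= f x <= 1) -> (forall x, 0 <= g x <= 1) ->
  f q = 1 -> g q = 1 ->
  (forall x, x < - M -> f x = 0) -> (forall x, M < x -> g x = 0) ->
  exists u : E1 M, lpart u =1 f /\ rpart u =1 g.
Proof.
move=> fm gm fc gc fi gi fq gq f0 g0.
pose u x := Num.min (f x) (g x).
have uM : level_set u 0 `<=` `[- M, M].
  rewrite /level_set eqxx => x.
  rewrite -[X in _ -> X _](_ : closure `[- M, M] = _).
    apply: closureS => y /=; rewrite /u lt_min in_itv /= => /andP[fy gy].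
    rewrite !leNgt; apply/andP; split.
      by apply/negP => /f0 y0; rewrite y0 ltxx in fy.
    by apply/negP => /g0 y0; rewrite y0 ltxx in gy.
  exact/esym/closure_id/itv_closed.
have hu : fuzzy_number u.
  split.
  - move=> x; have /andP[a b] := fi x; have /andP[c d] := gi x.
    by rewrite /u le_min ge_min a b c.
  - by exists q; rewrite /u fq gq minxx.
  - move=> x y l /andP[l0 l1]; have l1' : 0 <= 1 - l by rewrite subr_ge0.
    set z := l * x + _.
    wlog xy : x y l l0 l1 l1' @z / x <= y.
      move=> H; have [xy|/ltW yx] := leP x y; first exact: H.
      have zE : z = (1 - l) * y + (1 - (1 - l)) * x by rewrite /z; ring.
      by rewrite minC zE; apply: H => //; rewrite ?gerBl// opprB addrC subrK.
    have xz : x <= z by rewrite /z; nra.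
    have zy : z <= y by rewrite /z; nra.
    by rewrite /u le_min !ge_min (fm _ _ xz) (gm _ _ zy) !orbT.
  - move=> x a; rewrite /u gt_min => /orP[/fc|/gc]; apply: filterS => y ya.
      by rewrite gt_min ya.
    by rewrite gt_min ya orbT.
  - apply: subclosed_compact (@segment_compact _ (- M) M) uM.
    by rewrite /level_set eqxx; exact: closed_closure.
have uq : u q = 1 by rewrite /u fq gq minxx.
exists (exist _ u (conj hu uM)); split=> x.
  rewrite /lpart (left_partE _ _ uq)//; case: ltP => [xq|qx].
    have gx : g x = 1.
      apply/le_anti; have /andP[_ ->] := gi x.
      by rewrite -gq gm// ltW.
    by rewrite /u gx; apply/min_idPl; case/andP: (fi x).
  by apply/le_anti; have /andP[_ ->] := fi x; rewrite -fq fm.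
rewrite /rpart (right_partE _ _ uq)//; case: leP => [xq|/ltW qx].
  by apply/le_anti; have /andP[_ ->] := gi x; rewrite -gq gm.
have fx : f x = 1.
  apply/le_anti; have /andP[_ ->] := fi x.
  by rewrite -fq fm.
by rewrite /u fx; apply/min_idPr; case/andP: (gi x).
Qed.

(** * Monotonicity and semicontinuity of the parts *)

Lemma lpart_homo (R : realType) (M : R) (u : E1 M) :
  {homo lpart u : x y / x <= y}.
Proof.
have [q _ uq] := E1_peak u; have hu := E1_fuzzy u.
move=> x y xy; rewrite /lpart !(left_partE _ hu uq).
case: ifPn => [|]; case: ifPn => //; last first.
- by move=> yq; rewrite (le_lt_trans xy).
- by move=> _ _; case/andP: (fuzzy_itv hu x).
move=> yq _; have := fuzzy_between hu (_ : x <= y <= q).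
rewrite xy ltW// uq => /(_ isT); rewrite (min_idPl _)//.
by case/andP: (fuzzy_itv hu x).
Qed.

Lemma rpart_homo (R : realType) (M : R) (u : E1 M) :
  {homo rpart u : x y / x <= y >-> y <= x}.
Proof.
have [q _ uq] := E1_peak u; have hu := E1_fuzzy u.
move=> x y xy; rewrite /rpart !(right_partE _ hu uq).
case: (leP y q) => yq; case: (leP x q) => xq //.
- by have := lt_le_trans xq (le_trans xy yq); rewrite ltxx.
- by case/andP: (fuzzy_itv hu y).
have := fuzzy_between hu (_ : q <= x <= y).
rewrite xy ltW// uq => /(_ isT); rewrite (min_idPr _)//.
by case/andP: (fuzzy_itv hu y).
Qed.

Lemma lpart_usc (R : realType) (M : R) (u : E1 M) :
  upper_semicontinuous (lpart u).
Proof.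
have [q _ uq] := E1_peak u; have hu := E1_fuzzy u.
move=> x a; rewrite /lpart (left_partE _ hu uq).
case: (ltP x q) => [xq uxa|_ a1].
  near=> y; rewrite (left_partE _ hu uq) ifT; last first.
    by near: y; exact: (lt_nbhsl xq).
  by near: y; exact: (fuzzy_usc hu).
apply: filterE => y; apply: le_lt_trans a1.
by case/andP: (left_part_itv y hu).
Unshelve. all: by end_near. Qed.

Lemma rpart_usc (R : realType) (M : R) (u : E1 M) :
  upper_semicontinuous (rpart u).
Proof.
have [q _ uq] := E1_peak u; have hu := E1_fuzzy u.
move=> x a; rewrite /rpart (right_partE _ hu uq).
case: (leP x q) => [_ a1|xq uxa].
  apply: filterE => y; apply: le_lt_trans a1.
  by case/andP: (right_part_itv y hu).
near=> y; rewrite (right_partE _ hu uq) ifF.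
  by near: y; exact: (fuzzy_usc hu).
by apply/negbTE; rewrite -ltNge; near: y; exact: lt_nbhsr.
Unshelve. all: by end_near. Qed.

Lemma lpart0 (R : realType) (M : R) (u : E1 M) x : x < - M -> lpart u x = 0.
Proof.
move=> xM; have [q /andP[qM _] uq] := E1_peak u.
rewrite /lpart (left_partE _ (E1_fuzzy u) uq) (lt_le_trans xM)//.
by rewrite sval_out// leNgt xM.
Qed.

Lemma rpart0 (R : realType) (M : R) (u : E1 M) x : M < x -> rpart u x = 0.
Proof.
move=> xM; have [q /andP[_ qM] uq] := E1_peak u.
rewrite /rpart (right_partE _ (E1_fuzzy u) uq) leNgt (le_lt_trans qM)//=.
by rewrite sval_out// negb_and -!ltNge xM orbT.
Qed.

Lemma parts_peak (R : realType) (M : R) (u : E1 M) :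
  exists q, [/\ - M <= q <= M, lpart u q = 1 & rpart u q = 1].
Proof.
have [q qM uq] := E1_peak u; exists q; have hu := E1_fuzzy u.
split=> //; first by rewrite /lpart (left_partE _ hu uq) ltxx.
by rewrite /rpart (right_partE _ hu uq) lexx.
Qed.

(** This is what couples the two parts, and what makes both directions of the
    theorem work. *)
Lemma part_eq1 (R : realType) (M : R) (u : E1 M) x :
  lpart u x = 1 \/ rpart u x = 1.
Proof.
have [q _ uq] := E1_peak u; have hu := E1_fuzzy u.
rewrite /lpart /rpart (left_partE _ hu uq) (right_partE _ hu uq).
by case: (ltP x q) => [/ltW ->|_]; [right|left].
Qed.

(** * The mirror image *)

Lemma usc_opp (R : realType) (f : R -> R) :
  upper_semicontinuous f -> upper_semicontinuous (f \o -%R).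
Proof.
move=> fc x a /= fa; have /nbhs_ballP[e /= e0 ef] := fc _ _ fa.
apply/nbhs_ballP; exists e => // y; rewrite /ball /= => xy; apply: ef.
by rewrite /ball /= -opprD normrN.
Qed.

Lemma mirror_exists (R : realType) (M : R) (u : E1 M) :
  exists v : E1 M, (lpart v =1 rpart u \o -%R) /\ (rpart v =1 lpart u \o -%R).
Proof.
have [q [_ lq rq]] := parts_peak u.
apply: (@E1_of_parts _ _ _ _ (- q)) => /=.
- by move=> x y xy; apply: rpart_homo; rewrite lerN2.
- by move=> x y xy; apply: lpart_homo; rewrite lerN2.
- exact/usc_opp/rpart_usc.
- exact/usc_opp/lpart_usc.
- by move=> x; exact: rpart_itv.
- by move=> x; exact: lpart_itv.
- by rewrite opprK.
- by rewrite opprK.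
- by move=> x xM; apply: rpart0; rewrite ltrNr.
- by move=> x xM; apply: lpart0; rewrite ltrN2.
Qed.

Definition mirror (R : realType) (M : R) (u : E1 M) : E1 M :=
  projT1 (cid (mirror_exists u)).

Lemma lpart_mirror (R : realType) (M : R) (u : E1 M) x :
  lpart (mirror u) x = rpart u (- x).
Proof. by rewrite /mirror; case: cid => v /= [-> _]. Qed.

Lemma rpart_mirror (R : realType) (M : R) (u : E1 M) x :
  rpart (mirror u) x = lpart u (- x).
Proof. by rewrite /mirror; case: cid => v /= [_ ->]. Qed.

Lemma mirrorK (R : realType) (M : R) : involutive (@mirror R M).
Proof.
by move=> u; apply: E1_ext => x; rewrite !(lpart_mirror, rpart_mirror) opprK.
Qed.

(** * Reflection is an anti-isomorphism *)

(** By adjunction, the residuals in [fuzzyP] become inequalities between parts,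
    and the infimum becomes a universal quantifier. *)
Lemma le_hom (R : realType) (T : R -> R -> R) (M : R) (u v : E1 M) (r : R) :
  continuous_tnorm T -> 0 <= r <= 1 ->
  r <= E1hom T u v <-> forall x, T (lpart v x) r <= lpart u x /\
                                 T (rpart u x) r <= rpart v x.
Proof.
move=> hT hr; have inf_ok := fuzzyP_has_inf hT.1 (E1_fuzzy u) (E1_fuzzy v).
transitivity (forall x, r <= Num.min (residual T (lpart v x) (lpart u x))
                                     (residual T (rpart u x) (rpart v x))).
  split=> [ruv x|rx]; last first.
    by apply: lb_le_inf inf_ok.1 _ => _ [x _ <-]; exact: rx.
  by apply: le_trans ruv _; exact: (ge_inf inf_ok.2 (imageT _ x)).
split=> H x.
  have := H x; rewrite le_min => /andP[l2 r2].
  by split; apply/(residualP hT _ _ hr) => //;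
    (exact: lpart_itv || exact: rpart_itv).
have [l2 r2] := H x; rewrite le_min.
by apply/andP; split; apply/(residualP hT _ _ hr) => //;
  (exact: lpart_itv || exact: rpart_itv).
Qed.

Lemma hom_mirror (R : realType) (T : R -> R -> R) (M : R) (u v : E1 M) :
  continuous_tnorm T -> E1hom T (mirror u) (mirror v) = E1hom T v u.
Proof.
move=> hT; have [hi _ _] := E1_enriched M hT.
have sw (a b : E1 M) : E1hom T a b <= E1hom T (mirror b) (mirror a).
  apply: (le_hom (mirror b) (mirror a) hT (hi a b)).2 => x.
  rewrite !lpart_mirror !rpart_mirror.
  by have [] := (le_hom a b hT (hi a b)).1 (lexx _) (- x).
by apply/le_anti; rewrite sw andbT -{2}(mirrorK u) -{2}(mirrorK v) sw.
Qed.

(** * Consequences of duality and of the existence of colimits *)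

(** The infima that define limits and colimits are used only through this
    universal property, together with [eq_lower_cuts]. *)
Lemma residual_le_iff (R : realType) (T : R -> R -> R) (X : Type) (x0 : X)
    (w h : X -> R) (c : R) : continuous_tnorm T -> 0 <= c <= 1 ->
  (forall y, 0 <= w y <= 1) -> (forall y, 0 <= h y <= 1) ->
  c <= inf (range (fun y => residual T (w y) (h y))) <->
  (forall y, T (w y) c <= h y).
Proof.
move=> hT hc hw hh; split=> [cle y|le].
  apply/residualP => //; apply: le_trans cle _; apply: ge_inf; last by exists y.
  by exists 0 => _ [z _ <-]; case/andP: (residual_itv hT.1 (hw z) (hh z)).
apply: lb_le_inf; first by exists (residual T (w x0) (h x0)), x0.
by move=> _ [y _ <-]; apply/(residualP hT _ _ hc).
Qed.

Lemma inf_residual_itv (R : realType) (T : R -> R -> R) (X : Type) (x0 : X)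
    (w h : X -> R) : is_tnorm T ->
  (forall y, 0 <= w y <= 1) -> (forall y, 0 <= h y <= 1) ->
  0 <= inf (range (fun y => residual T (w y) (h y))) <= 1.
Proof.
move=> hT hw hh; have ri y := residual_itv hT (hw y) (hh y).
apply/andP; split.
  apply: lb_le_inf; first by exists (residual T (w x0) (h x0)), x0.
  by move=> _ [y _ <-]; case/andP: (ri y).
apply: (@le_trans _ _ (residual T (w x0) (h x0))); last by case/andP: (ri x0).
by apply: ge_inf; [exists 0 => _ [y _ <-]; case/andP: (ri y)|exists x0].
Qed.

Lemma eq_lower_cuts (R : realType) (a b : R) : 0 <= a <= 1 -> 0 <= b <= 1 ->
  (forall c, 0 <= c <= 1 -> c <= a <-> c <= b) -> a = b.
Proof.
move=> ha hb H; apply/le_anti/andP; split.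
  by apply/(H _ ha).
by apply/(H _ hb).
Qed.

(** A self-dual category is isomorphic to its opposite, and weights on it are
    coweights on the opposite: the colimit of [phi] is [s] of the limit of
    [phi \o s]. *)
Lemma self_dual_cocomplete (R : realType) (T : R -> R -> R) (X : Type)
    (hom : X -> X -> R) (s : X -> X) : involutive s ->
  (forall x y, hom (s x) (s y) = hom y x) ->
  complete T hom -> cocomplete T hom.
Proof.
move=> sK hs hcomp phi [phi01 hphi]; have [|l hl] := hcomp (phi \o s).
  by split=> [x|x y] /=; [exact: phi01|rewrite -hs].
exists (s l) => x; rewrite -[x in LHS]sK hs hl; congr inf.
apply/seteqP; split=> _ [y _ <-] /=.
  by exists (s y) => //; rewrite -{1}(sK x) hs.
by exists (s y) => //=; rewrite sK hs.
Qed.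

Lemma self_dual_cotensored (R : realType) (T : R -> R -> R) (X : Type)
    (hom : X -> X -> R) (s : X -> X) : involutive s ->
  (forall x y, hom (s x) (s y) = hom y x) ->
  tensored T hom -> cotensored T hom.
Proof.
move=> sK hs tens r y hr; have [t ht] := tens r (s y) hr.
by exists (s t) => x; rewrite -[x in LHS]sK hs ht hs.
Qed.

(** The colimit of the weight [r & hom(-, x)] is the tensor, by a Yoneda
    argument: the infimum is attained at [x]. *)
Lemma cocomplete_tensored (R : realType) (T : R -> R -> R) (X : Type)
    (hom : X -> X -> R) : continuous_tnorm T -> enriched_category T hom ->
  cocomplete T hom -> tensored T hom.
Proof.
move=> hT [hi h1 hc] cocomp r x hr; have tn := hT.1.
have ti y : 0 <= T r (hom y x) <= 1 by exact: (tnorm_itv tn).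
have [|t ht] := cocomp (fun y => T r (hom y x)).
  split=> // a b; apply/residualP => //; rewrite -(tnormA tn)//.
  by apply: (tnorm_monor tn) => //; apply: (tnorm_itv tn).
exists t => y; rewrite ht; apply: eq_lower_cuts.
- exact: inf_residual_itv.
- exact: residual_itv.
move=> c hc01; rewrite (residual_le_iff x)// -residualP//; split=> [H|H z].
  by have := H x; rewrite h1 (tnorm1 tn).
rewrite -(tnormA tn) // (tnormC tn (hi _ _) hc01) (tnormA tn) //.
apply: le_trans (hc z x y); apply: (tnorm_monol tn) => //.
exact: (tnorm_itv tn).
Qed.

(** * Cotensors force idempotence *)

Lemma tnormC1 (R : realType) (T : R -> R -> R) (x : R) :
  is_tnorm T -> 0 <= x <= 1 -> T 1 x = x.
Proof.
by move=> hT hx; rewrite (tnormC hT) ?(tnorm1 hT)// lexx ler01.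
Qed.

Lemma tnorm_lel (R : realType) (T : R -> R -> R) (x y : R) :
  is_tnorm T -> 0 <= x <= 1 -> 0 <= y <= 1 -> T x y <= x.
Proof.
move=> hT hx hy; rewrite -[leRHS](tnorm1 hT)//.
by apply: (tnorm_monor hT) => //; [rewrite lexx ler01|case/andP: hy].
Qed.

(** For [x <= y] one has [x <= T x x <= T x y <= x]. *)
Lemma tnorm_idem_min (R : realType) (T : R -> R -> R) : is_tnorm T ->
  (forall r, 0 <= r <= 1 -> r <= T r r) ->
  forall x y, 0 <= x <= 1 -> 0 <= y <= 1 -> T x y = Num.min x y.
Proof.
move=> hT idem x y; wlog xy : x y / x <= y => [H|] hx hy.
  have [|/ltW yx] := leP x y; first by move=> xy; rewrite H// (min_idPl xy).
  by rewrite (tnormC hT)// H// (min_idPl yx).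
rewrite (min_idPl xy); apply/le_anti; rewrite tnorm_lel//=.
by apply: le_trans (idem x hx) _; exact: (tnorm_monor hT).
Qed.

(** The test object: the level [c] on [[-M, M[] and the peak at [M]. *)
Lemma step_exists (R : realType) (M c : R) : 0 < M -> 0 <= c <= 1 ->
  exists u : E1 M,
    (forall x, lpart u x = if x < - M then 0 else if x < M then c else 1) /\
    (forall x, rpart u x = if x <= M then 1 else 0).
Proof.
move=> M0 /andP[c0 c1]; have MM : - M < M by rewrite gtrN.
apply: (@E1_of_parts _ _ _ _ M).
- move=> x y xy; case: (ltP y (- M)) => yM.
    by rewrite (le_lt_trans xy yM).
  case: (ltP x (- M)) => xM; first by case: ifP.
  case: (ltP y M) => yM'; first by rewrite (le_lt_trans xy yM').
  by case: ifP.
- move=> x y xy; case: (leP y M) => yM; first by rewrite (le_trans xy yM).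
  by case: ifP.
- move=> x a; case: (ltP x (- M)) => xM.
    move=> a0; near=> y; rewrite ifT//; near: y; exact: (lt_nbhsl xM).
  case: (ltP x M) => xM' ca; near=> y.
    have yM : y < M by near: y; exact: (lt_nbhsl xM').
    by case: ifP => _; rewrite ?yM// (le_lt_trans c0).
  by do 2?case: ifP => _ //; apply: le_lt_trans ca.
- move=> x a; case: (leP x M) => xM ca; near=> y.
    by case: ifP => _ //; apply: le_lt_trans ca.
  rewrite ifF//; apply/negbTE; rewrite -ltNge; near: y; exact: (lt_nbhsr xM).
- by move=> x; do 2?case: ifP => _; rewrite ?lexx ?ler01 ?c0.
- by move=> x; case: ifP => _; rewrite ?lexx ?ler01.
- by rewrite ltNge (ltW MM) ltxx.
- by rewrite lexx.
- by move=> x ->.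
- by move=> x; rewrite leNgt => ->.
Unshelve. all: by end_near. Qed.

(** If [r] were not idempotent, the cotensor by [r] of [mirror u], for the step
    [u] at level [T r r], would have both parts below 1 at 0. *)
Lemma cotensored_idem (R : realType) (T : R -> R -> R) (M r : R) :
  continuous_tnorm T -> 0 < M -> cotensored T (@E1hom R T M) ->
  0 <= r <= 1 -> r <= T r r.
Proof.
move=> hT M0 cot hr; have tn := hT.1; have [hi h1 _] := E1_enriched M hT.
have i0 : 0 <= (0 : R) <= 1 by rewrite lexx ler01.
have i1 : 0 <= (1 : R) <= 1 by rewrite lexx ler01.
set c := T r r; have hc : 0 <= c <= 1 by exact: (tnorm_itv tn).
have [c0 c1] := andP hc.
have [u [ul ur]] := step_exists M0 hc.
have T1c : T 1 c = c by exact: tnormC1.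
have T0c : T 0 c <= 0 by exact: tnorm_lel.
have u0 : lpart u 0 = c by rewrite ul oppr_gt0 ltNge (ltW M0) M0.
have [L hL] := cot r (mirror u) hr.
(* Both conditions in [c <= P(u, mirror u)] reduce to [key]. *)
have rL : r <= E1hom T u L.
  rewrite hL; apply/(residualP hT hr (hi _ _) hr).
  apply: (le_hom u (mirror u) hT hc).2 => t.
  have key s : T (rpart u s) c <= lpart u (- s).
    rewrite ur ul ltrN2; case: (leP s M) => //= sM; rewrite T1c.
    by case: ifP.
  by rewrite lpart_mirror rpart_mirror; split; rewrite ?key// -{2}(opprK t).
(* The cotensor property at [L] itself, where [P(L, L) = 1]. *)
have rLy : r <= E1hom T L (mirror u).
  rewrite -(tnorm1 tn hr); apply: (residualP hT hr (hi _ _) i1).2.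
  by rewrite -hL h1.
have [lc _] := (le_hom u L hT hr).1 rL 0.
have [_ rc] := (le_hom L (mirror u) hT hr).1 rLy 0.
rewrite rpart_mirror oppr0 in rc; rewrite u0 in lc rc.
by case: (part_eq1 L 0) => e; [move: lc|move: rc]; rewrite e tnormC1.
Qed.

(** * Semicontinuous envelopes *)

(** By adjunction [residual T p (g y) < a] is the open condition
    [g y < T p a]. *)
Lemma residual_usc (R : realType) (T : R -> R -> R) (p : R) (g : R -> R) :
  continuous_tnorm T -> 0 <= p <= 1 -> (forall x, 0 <= g x <= 1) ->
  upper_semicontinuous g -> upper_semicontinuous (fun x => residual T p (g x)).
Proof.
move=> hT hp gi gc x a ra; have ri y := residual_itv hT.1 hp (gi y).
have [a1|a1] := ltP 1 a.
  by apply: filterE => y; apply: le_lt_trans a1; case/andP: (ri y).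
have ha : 0 <= a <= 1.
  by rewrite a1 andbT (le_trans _ (ltW ra)) //; case/andP: (ri x).
have E y : (residual T p (g y) < a) = (g y < T p a).
  rewrite !ltNge; congr (~~ _).
  by apply/idP/idP => /(residualP hT hp (gi y) ha).
rewrite E in ra; near=> y; rewrite E; near: y; exact: gc.
Unshelve. all: by end_near. Qed.

Lemma usc_inf (R : realType) (X : Type) (F : X -> R -> R) (x0 : X) :
  (forall y t, 0 <= F y t) -> (forall y, upper_semicontinuous (F y)) ->
  upper_semicontinuous (fun t => inf (range (F^~ t))).
Proof.
move=> F0 Fc t a Fa; have [|_ [y _ <-] ya] := inf_lt _ Fa.
  by exists (F x0 t), x0.
near=> s; apply: (@le_lt_trans _ _ (F y s)); last by near: s; exact: Fc.
by apply: ge_inf; [exists 0 => _ [z _ <-]|exists y].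
Unshelve. all: by end_near. Qed.

Lemma usc_cutoff (R : realType) (B : R -> R) (b : R) :
  (forall t, 0 <= B t) -> upper_semicontinuous B ->
  upper_semicontinuous (fun t => if t <= b then B t else 0).
Proof.
move=> B0 Bc t a; case: (leP t b) => tb Ba.
  have a0 : 0 < a by exact: le_lt_trans Ba.
  by near=> s; case: ifP => // _; near: s; exact: Bc.
near=> s; rewrite ifF//; apply/negbTE; rewrite -ltNge.
by near: s; exact: (lt_nbhsr tb).
Unshelve. all: by end_near. Qed.

(** For an increasing [A] this is the right limit [A(t+)], its smallest
    right-continuous majorant. As an infimum over a half-line it is increasing
    and upper semicontinuous for every [A] bounded below. *)
Definition right_env (R : realType) (A : R -> R) (t : R) : R :=
  inf [set A s | s in [set s | t < s]].

Lemma right_env_le (R : realType) (A : R -> R) (t s : R) :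
  (forall x, 0 <= A x <= 1) -> t < s -> right_env A t <= A s.
Proof.
move=> Ai ts; apply: ge_inf; last by exists s.
by exists 0 => _ [z _ <-]; case/andP: (Ai z).
Qed.

Lemma le_right_env (R : realType) (A : R -> R) (t c : R) :
  (forall s, t < s -> c <= A s) -> c <= right_env A t.
Proof.
move=> cA; apply: lb_le_inf; last by move=> _ [s /= ts <-]; exact: cA.
by exists (A (t + 1)), (t + 1) => //=; rewrite ltrDl.
Qed.

Lemma right_env_itv (R : realType) (A : R -> R) (t : R) :
  (forall x, 0 <= A x <= 1) -> 0 <= right_env A t <= 1.
Proof.
move=> Ai; apply/andP; split.
  by apply: le_right_env => s _; case/andP: (Ai s).
have tt : t < t + 1 by rewrite ltrDl.
by apply: le_trans (right_env_le Ai tt) _; case/andP: (Ai (t + 1)).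
Qed.

Lemma right_env_homo (R : realType) (A : R -> R) :
  (forall x, 0 <= A x <= 1) -> {homo right_env A : x y / x <= y}.
Proof.
move=> Ai x y xy; apply: le_right_env => s ys.
exact: right_env_le (le_lt_trans xy ys).
Qed.

Lemma right_env_usc (R : realType) (A : R -> R) :
  (forall x, 0 <= A x <= 1) -> upper_semicontinuous (right_env A).
Proof.
move=> Ai x a /inf_lt[|_ [s /= xs <-] As].
  by exists (A (x + 1)), (x + 1) => //=; rewrite ltrDl.
near=> y; apply: le_lt_trans As; apply: right_env_le => //.
by near: y; exact: (lt_nbhsl xs).
Unshelve. all: by end_near. Qed.

(** Left parts satisfy a lower bound at [t] as soon as they do on the right of
    [t], so passing from [A] to [right_env A] adds no constraint on them. *)
Lemma usc_ge_right (R : realType) (h : R -> R) (t c : R) :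
  upper_semicontinuous h -> (forall s, t < s -> c <= h s) -> c <= h t.
Proof.
move=> hc ch; rewrite leNgt; apply/negP => /hc/nbhs_ballP[e /= e0 he].
have te : t < t + e / 2 by rewrite ltrDl divr_gt0.
have /he /= : ball t e (t + e / 2).
  rewrite /ball /= opprD addNKr normrN gtr0_norm ?divr_gt0//.
  by rewrite ltr_pdivrMr// ltr_pMr// ltr1n.
by rewrite ltNge ch.
Qed.

(** The point [q] is the supremum of the points where [g] is 1; it belongs to
    this set by upper semicontinuity. *)
Lemma usc_last_one (R : realType) (g : R -> R) (a b : R) :
  upper_semicontinuous g -> {homo g : x y / x <= y >-> y <= x} ->
  (forall x, 0 <= g x <= 1) -> g a = 1 -> (forall x, b < x -> g x = 0) ->
  exists q, [/\ a <= q, g q = 1 & forall x, q < x -> g x < 1].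
Proof.
move=> gc gm gi ga g0; pose S := [set x | g x = 1].
have ubS : has_ubound S.
  exists b => x /= gx; rewrite leNgt; apply/negP => /g0/eqP.
  by rewrite gx oner_eq0.
have lt1 x : g x != 1 -> g x < 1.
  by rewrite lt_neqAle => ->; case/andP: (gi x).
exists (sup S); split; first exact: ub_le_sup.
- apply/eqP; apply: contraT => /lt1/gc/nbhs_ballP[e /= e0 eg].
  have [x Sx ex] := sup_adherent e0 (conj (ex_intro _ a ga) ubS).
  have xS : x <= sup S by exact: ub_le_sup.
  have /eg : ball (sup S) e x.
    by rewrite /ball /= ger0_norm ?subr_ge0// ltrBlDl -ltrBlDr.
  by rewrite Sx ltxx.
- move=> x Sx; apply: lt1; apply: contraTneq Sx => gx.
  by rewrite -leNgt; exact: ub_le_sup.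
Qed.

Lemma le_sup_range (R : realType) (X : Type) (F : X -> R) (y : X) :
  (forall y, 0 <= F y <= 1) -> F y <= sup (range F).
Proof.
move=> Fi; apply: ub_le_sup; last by exists y.
by exists 1 => _ [z _ <-]; case/andP: (Fi z).
Qed.

Lemma sup_range_itv (R : realType) (X : Type) (x0 : X) (F : X -> R) :
  (forall y, 0 <= F y <= 1) -> 0 <= sup (range F) <= 1.
Proof.
move=> Fi; apply/andP; split.
  by apply: le_trans (le_sup_range x0 Fi); case/andP: (Fi x0).
by apply: ge_sup; [exists (F x0), x0|move=> _ [y _ <-]; case/andP: (Fi y)].
Qed.

(** * Limits for the minimum t-norm *)

(** The right part of the limit is [inf_y (psi y -> y^r)], cut off at [M]; the
    left part is the right limit of [sup_y (psi y & y^l)], raised to 1 past the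
    last point [q] where the right part is 1. *)
Lemma min_complete (R : realType) (T : R -> R -> R) (M : R) :
  continuous_tnorm T -> 0 < M ->
  (forall x y, 0 <= x <= 1 -> 0 <= y <= 1 -> T x y = Num.min x y) ->
  complete T (@E1hom R T M).
Proof.
move=> hT M0 Tmin psi [psi01 _]; have tn := hT.1.
have [hi _ _] := E1_enriched M hT.
have i0 : 0 <= (0 : R) <= 1 by rewrite lexx ler01.
have i1 : 0 <= (1 : R) <= 1 by rewrite lexx ler01.
have [x0 _] := step_exists M0 i0.
have mi (a b : R) : 0 <= a <= 1 -> 0 <= b <= 1 -> 0 <= Num.min a b <= 1.
  by move=> /andP[a0 a1] /andP[b0 b1]; rewrite le_min ge_min a0 b0 a1.
pose B t := inf (range (fun y : E1 M => residual T (psi y) (rpart y t))).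
pose A t := sup (range (fun y : E1 M => Num.min (psi y) (lpart y t))).
have Bi t : 0 <= B t <= 1.
  by apply: inf_residual_itv => // y; exact: rpart_itv.
have Fi t (y : E1 M) : 0 <= Num.min (psi y) (lpart y t) <= 1.
  exact: mi (psi01 y) (lpart_itv y t).
have Ai t : 0 <= A t <= 1 by exact: sup_range_itv.
have leB t c : 0 <= c <= 1 ->
    c <= B t <-> forall y, Num.min (psi y) c <= rpart y t.
  move=> hc; have ri (y : E1 M) : 0 <= rpart y t <= 1 := rpart_itv y t.
  rewrite /B (residual_le_iff x0 hT hc psi01 ri).
  by split=> H y; have := H y; rewrite Tmin.
(* The cutoff matters: [B t = 1] for every [t] if [psi] vanishes. *)
pose g t := if t <= M then B t else 0.
have gi t : 0 <= g t <= 1 by rewrite /g; case: ifP.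
have gm : {homo g : x y / x <= y >-> y <= x}.
  move=> s t st; rewrite /g; case: (leP t M) => tM; last first.
    by case: ifP => // _; case/andP: (Bi s).
  rewrite (le_trans st tM); apply/(leB _ _ (Bi t)) => y.
  apply: le_trans (rpart_homo y st); exact: ((leB _ _ (Bi t)).1 (lexx _)).
have gc : upper_semicontinuous g.
  apply: usc_cutoff => [t|]; first by case/andP: (Bi t).
  apply: usc_inf x0 _ _ => [y t|y]; last first.
    exact: (residual_usc hT (psi01 y) (rpart_itv y) (@rpart_usc _ _ y)).
  by case/andP: (residual_itv tn (psi01 y) (rpart_itv y t)).
have gM : g (- M) = 1.
  apply/le_anti; case/andP: (gi (- M)) => _ -> /=.
  rewrite /g ifT; last by rewrite ltW// gtrN.
  apply/(leB _ _ i1) => y; have [q [/andP[Mq _] _ rq]] := parts_peak y.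
  by apply: le_trans (rpart_homo y Mq); rewrite rq ge_min lexx orbT.
have g0 t : M < t -> g t = 0 by rewrite /g ltNge; case: ifP.
have [q [Mq gq gq1]] := usc_last_one gc gm gi gM g0.
(* Raising [A] to 1 where [g < 1] makes the two parts meet at [q]. *)
pose A' t := if g t < 1 then 1 else A t.
have Ai' t : 0 <= A' t <= 1 by rewrite /A'; case: ifP.
have fq : right_env A' q = 1.
  apply/le_anti; case/andP: (right_env_itv q Ai') => _ -> /=.
  by apply: le_right_env => s /gq1; rewrite /A' => ->.
have f0 t : t < - M -> right_env A' t = 0.
  move=> tM; apply/le_anti; case/andP: (right_env_itv t Ai') => -> _.
  rewrite andbT; have [ts sM] := midf_lt tM; set s := _ / _ in ts sM.
  apply: le_trans (right_env_le Ai' ts) _.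
  have g1 : 1 <= g s by rewrite -gM gm// ltW.
  rewrite /A' ltNge g1 /=; apply: ge_sup.
    by exists (Num.min (psi x0) (lpart x0 s)), x0.
  by move=> _ [y _ <-]; rewrite lpart0// ge_min lexx orbT.
have [L [Ll Lr]] := E1_of_parts (right_env_homo Ai') gm (right_env_usc Ai') gc
  (fun x => right_env_itv x Ai') gi fq gq f0 g0.
exists L => x; apply: eq_lower_cuts => [||r hr].
- exact: hi.
- exact: inf_residual_itv.
rewrite (residual_le_iff x0 hT hr psi01 (fun y => hi x y)).
have li (y : E1 M) t := lpart_itv y t.
have ri (y : E1 M) t := rpart_itv y t.
split=> [/(le_hom x L hT hr) H y|H].
  have hp := tnorm_itv tn (psi01 y) hr.
  apply: (le_hom x y hT hp).2 => t; have [] := H t.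
  rewrite Ll Lr !Tmin ?mi//; last exact: right_env_itv.
  move=> Hl Hr; split.
    apply: le_trans Hl; rewrite minA le_min.
    apply/andP; split; rewrite ge_min; last by rewrite lexx orbT.
    apply/orP; left; apply: le_right_env => s ts.
    rewrite /A'; case: ifP => _.
      by rewrite minC; case/andP: (Fi t y).
    apply: le_trans (le_sup_range y (Fi s)).
    by rewrite minC le_min !ge_min lexx (lpart_homo y (ltW ts)) orbT.
  have [tM|/rpart0 ->] := leP t M; last first.
    by rewrite ge_min; case/andP: (ri y t) => ->.
  rewrite minCA; apply: ((leB _ _ _).1 _ y); first exact: mi.
  by move: Hr; rewrite /g tM.
apply: (le_hom x L hT hr).2 => t; rewrite Ll Lr.
have {}H y s : Num.min (lpart y s) (Num.min (psi y) r) <= lpart x s /\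
    Num.min (rpart x s) (Num.min (psi y) r) <= rpart y s.
  have hp := tnorm_itv tn (psi01 y) hr.
  by have := (le_hom x y hT hp).1 (H y) s; rewrite !Tmin ?mi.
rewrite !Tmin//; last by exact: right_env_itv.
have Hg s : Num.min (rpart x s) r <= g s.
  rewrite /g; case: (leP s M) => sM; last by rewrite rpart0// ge_min lexx.
  apply/leB => [|y]; first exact: mi.
  by rewrite minCA; have [] := H y s.
split=> //; apply: (usc_ge_right (@lpart_usc _ _ x)) => s ts.
apply: (@le_trans _ _ (Num.min (A' s) r)).
  by rewrite le_min !ge_min lexx (right_env_le Ai' ts) orbT.
rewrite /A'; case: ifPn => [g1|_]; last first.
  rewrite leNgt; apply/negP; rewrite lt_min => /andP[xA xr].
  have [|_ [y _ <-] xy] := sup_gt _ xA.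
    by exists (Num.min (psi x0) (lpart x0 s)), x0.
  have [+ _] := H y s; rewrite leNgt => /negP; apply.
  by move: xy; rewrite !lt_min xr => /andP[-> ->].
(* Remaining case [g s < 1], where [A'] was raised: [r <= lpart x s] is due
   although it is not one of the conditions in [H]. *)
rewrite (min_idPr _); last by case/andP: hr.
case: (part_eq1 x s) => [->|x1]; first by case/andP: hr.
have sM : s <= M.
  by rewrite leNgt; apply/negP => /(rpart0 x)/eqP; rewrite x1 oner_eq0.
have [y yp] : exists y, rpart y s < psi y.
  apply: contrapT => /forallNP no.
  move: g1; rewrite /g sM ltNge => /negP; apply.
  apply/leB => // y; rewrite ge_min leNgt; apply/orP; left; exact/negP.
have [Hl Hr] := H y s; rewrite x1 (min_idPr _) in Hr; last first.
  by rewrite ge_min; case/andP: hr => _ ->; rewrite orbT.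
have yl : lpart y s = 1.
  case: (part_eq1 y s) => // y1; move: yp; rewrite y1 ltNge.
  by case/andP: (psi01 y) => _ ->.
move: Hr; rewrite ge_min leNgt yp /= => ry.
have rp : r <= psi y by exact: le_trans ry (ltW yp).
move: Hl; rewrite yl (min_idPr rp) (min_idPr _)//.
by case/andP: hr.
Qed.

Theorem theorem4p11 (R : realType) (T : R -> R -> R) (M : R)
    (hT : continuous_tnorm T) (hM : 0 < M) :
  [<-> complete T (@E1hom R T M);
       cocomplete T (@E1hom R T M);
       tensored T (@E1hom R T M);
       cotensored T (@E1hom R T M);
       forall x y : R, 0 <= x <= 1 -> 0 <= y <= 1 -> T x y = Num.min x y].
Proof.
have dual (u v : E1 M) := hom_mirror u v hT.
have enr := E1_enriched M hT.
tfae.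
- exact: (self_dual_cocomplete (@mirrorK R M) dual).
- exact: (cocomplete_tensored hT enr).
- exact: (self_dual_cotensored (@mirrorK R M) dual).
- move=> cot; apply: (tnorm_idem_min hT.1) => r.
  exact: (cotensored_idem hT hM cot).
- exact: (min_complete hT hM).
Qed.
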